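(* Let $M=1$. Then for any $x>1$ the set $\mathcal{U}(x)$ contains isolated points.
   Context: For $M=1$: for $q\in(1,2]$ and $x\ge0$, a $q$-expansion of $x$ is a sequence $(d_i)_{i\ge1}\in\{0,1\}^{\mathbb{N}}$ with $x=\sum_{i\ge1}d_iq^{-i}$, and $\mathcal{U}(x)$ is the set of $q\in(1,2]$ such that $x$ has exactly one $q$-expansion. An isolated point of $\mathcal{U}(x)$ is a point $p\in\mathcal{U}(x)$ with $\mathcal{U}(x)\cap(p-\varepsilon,p+\varepsilon)=\{p\}$ for some $\varepsilon>0$. *)

(* Defs.v *)
From HB Require Import structures.
From mathcomp Require Import all_boot all_order all_algebra.
From mathcomp Require Import all_classical all_reals all_analysis.

Set Implicit Arguments.
Unset Strict Implicit.
Unset Printing Implicit Defensive.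

Import Order.TTheory GRing.Theory Num.Theory.
Import numFieldNormedType.Exports.

Local Open Scope classical_set_scope.
Local Open Scope ring_scope.

(* Digits d_1, d_2, ... are indexed from 0, so [d i] is the digit d_(i+1),
   and [true], [false] are the digits 1, 0. *)
Definition is_qexpansion (R : realType) (q x : R) (d : nat -> bool) : Prop :=
  series (fun i => (d i)%:R * q ^- i.+1) @ \oo --> x.

Definition univoque_bases (R : realType) (x : R) : set R :=
  [set q | 1 < q <= 2 /\ exists! d : nat -> bool, is_qexpansion q x d].

(* Main.v *)
Require Import Defs.
From mathcomp Require Import all_boot all_order all_algebra.
From mathcomp Require Import all_classical all_reals all_analysis.
From mathcomp Require Import zify ring lra.

(* Write [theta] for the substitution 1 -> 10, 0 -> 01 and let [alpha n] be the
   n-th iterate of d |-> 1 theta(d) on 0^oo: these are the quasi-greedy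
   expansions of 1 in bases q_1 < q_2 < ... increasing to the Komornik-Loreti
   constant.  If q < q_N, every tail of a unique expansion following a 0 (or the
   complement of a tail following a 1) is lexicographically below [alpha N].
   Desubstituting, such a sequence is eventually theta^m of a constant sequence
   for some m < N, its rank, and other such sequences close to it have strictly
   larger rank.  Since nearby bases in U(x) carry close expansions, a base
   q < q_N in U(x) of maximal rank is isolated.
   It remains to find a base below the Komornik-Loreti constant in U(x).  The
   sequence (1 theta)^m (1^k (10)^oo) is a unique expansion in every base
   q > q_(m+1), and for x > 1 some m, k give x in a base of
   ]q_(m+1), q_(m+2)], because the intervals of values so obtained for
   consecutive k overlap (for x at least the golden ratio, 1^oo works). *)

Set Implicit Arguments.
Unset Strict Implicit.
Unset Printing Implicit Defensive.

Import Order.TTheory GRing.Theory Num.Theory.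
Import numFieldNormedType.Exports.

(** * Sequences governed by the Thue-Morse substitution *)

Local Open Scope nat_scope.

Definition scons (b : bool) (d : nat -> bool) : nat -> bool :=
  fun k => if k is k'.+1 then d k' else b.
Definition sdrop (i : nat) (d : nat -> bool) : nat -> bool := fun k => d (i + k).
Definition neg (d : nat -> bool) : nat -> bool := fun k => ~~ d k.

Definition theta (d : nat -> bool) : nat -> bool := fun k => d k./2 (+) odd k.
Definition Phi (d : nat -> bool) : nat -> bool := scons true (theta d).

Definition lexlt (s t : nat -> bool) : Prop :=
  exists j, [/\ forall i, i < j -> s i = t i, s j = false & t j = true].

(* The tail of [c] after its i-th digit, complemented when that digit is 1, so
   that one condition covers both digits. *)
Definition rtail (c : nat -> bool) (i : nat) : nat -> bool :=
  fun k => c i (+) c (i + k.+1).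

Definition below (a c : nat -> bool) : Prop := forall i, lexlt (rtail c i) a.

Definition alpha (n : nat) : nat -> bool := iter n Phi (fun=> false).

Lemma theta_even d t : theta d t.*2 = d t.
Proof. by rewrite /theta doubleK odd_double addbF. Qed.

Lemma theta_odd d t : theta d t.*2.+1 = ~~ d t.
Proof. by rewrite /theta /= uphalf_double odd_double addbT. Qed.

Lemma theta_of_blocks d :
  (forall t, d t.*2.+1 = ~~ d t.*2) -> d = theta (fun t => d t.*2).
Proof.
move=> h; apply/funext => k; rewrite -{1}(odd_double_half k) /theta.
by case: (odd k); rewrite ?addbT ?addbF /= ?add0n ?add1n ?h.
Qed.

Lemma rtail_sdrop c i j : rtail (sdrop i c) j = rtail c (i + j).
Proof. by apply/funext => k; rewrite /rtail /sdrop addnA. Qed.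

Lemma rtail_rtail c i j : rtail (rtail c i) j = rtail c (i + j.+1).
Proof.
apply/funext => k; rewrite /rtail.
have -> : i + (j + k.+1).+1 = i + j.+1 + k.+1 by lia.
by case: (c i); case: (c _); case: (c _).
Qed.

Lemma below_sdrop a c i : below a c -> below a (sdrop i c).
Proof. by move=> h j; rewrite rtail_sdrop. Qed.

(** The second digit of a block is the complement of the first, which gives the leading 1 of [Phi];
    the later blocks follow since [theta] commutes with complementation. *)
Lemma rtail_theta c t : rtail (theta c) t.*2 = Phi (rtail c t).
Proof.
apply/funext => -[|k]; rewrite /rtail /Phi /= theta_even.
  by rewrite addn1 theta_odd; case: (c t).
rewrite /theta.
have -> : t.*2 + k.+2 = (t + k./2.+1).*2 + odd k by have := odd_double_half k; lia.
by rewrite halfD odd_double doubleK oddD odd_double /= oddb; case: (odd k);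
  rewrite ?add0n ?addn0; case: (c t); case: (c _).
Qed.

(** A block is determined by its first digit, so the first difference of two images under [theta]
    opens a block. *)
Lemma lexlt_Phi a b : lexlt (Phi a) (Phi b) <-> lexlt a b.
Proof.
split=> [[[|j] [h h1 h2]] //|[j [h h1 h2]]]; last first.
  exists j.*2.+1; split=> [[|i] //= hi|/=|/=]; rewrite ?theta_even //.
  by rewrite /theta h //; have := odd_double_half i; lia.
move: h1 h2; rewrite /= -(odd_double_half j); case oj: (odd j) => /=.
  rewrite add1n !theta_odd => h1 h2.
  have := h (j./2).*2.+1; rewrite /= !theta_even => h3.
  by move: h1 h2; rewrite h3; [case: (b _)|have := odd_double_half j; lia].
rewrite add0n !theta_even => h1 h2; exists j./2; split=> // i hi.
by have := h i.*2.+1; rewrite /= !theta_even; apply; have := odd_double_half j; lia.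
Qed.

Lemma below_theta a e : below (Phi a) (theta e) -> below a e.
Proof. by move=> h t; have := h t.*2; rewrite rtail_theta lexlt_Phi. Qed.

(* The word 0 1 (10)^r 11 cannot occur: its tail 1 (10)^r 11 exceeds every Phi f. *)
Lemma below_no_early_double f c j r : below (Phi f) c -> c j.+1 = ~~ c j ->
  (forall s, s <= r -> c (j + s.*2.+2) = ~~ c j) ->
  (forall s, s < r -> c (j + s.*2.+3) = c j) ->
  c (j + r.*2.+3) = c j.
Proof.
move=> Yc h1 h2 h3; apply/eqP/negP => /negP hne.
have h4 : c (j + r.*2.+3) = ~~ c j by move: hne; case: (c _); case: (c j).
have [[|k] [hk]] := Yc j; rewrite /rtail ?addn1 /=.
  by rewrite h1; case: (c j).
move=> hc ht; case: (ltnP r.*2.+1 k) => hrk.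
  have := hk r.*2.+1 ltac:(lia); have := hk r.*2.+2 ltac:(lia).
  by rewrite /rtail /= theta_even theta_odd h2 // h4; case: (c j); case: (f r).
move: hc ht hk hrk; rewrite -(odd_double_half k); case: (odd k).
  rewrite add1n theta_odd => hc ht hk hrk.
  have [er|hr] := eqVneq k./2 r.
    by move: hc; rewrite er h4; case: (c j).
  have := hk (k./2).*2.+1 ltac:(lia); rewrite /rtail /= theta_even h2; last lia.
  by move: ht; case: (f _); case: (c j).
rewrite add0n theta_even => hc ht hk hrk.
by move: hc; rewrite h2; [case: (c j)|lia].
Qed.

(** Up to complement, [c] reads 0 1 (10)^r 1 from [j] on, so the next digit is 0. The digit after it
    is either 0, which starts a complemented word of this kind with r = 0 at [j + r.*2.+2], or 1,
    which lengthens the present word. *)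
Lemma below_blocks f c t : below (Phi f) c -> forall j r, c j.+1 = ~~ c j ->
  (forall s, s <= r -> c (j + s.*2.+2) = ~~ c j) ->
  (forall s, s < r -> c (j + s.*2.+3) = c j) ->
  c (j + (r + t).*2.+3) = ~~ c (j + (r + t).*2.+2).
Proof.
move=> Yc; elim: t => [|t IH] j r h1 h2 h3; have h4 := below_no_early_double Yc h1 h2 h3.
  by rewrite addn0 h4 h2 // negbK.
have [e|ne] := eqVneq (c (j + r.*2.+4)) (c j).
  have := IH (j + r.*2.+2) 0; rewrite add0n.
  have -> : j + r.*2.+2 + t.*2.+3 = j + (r + t.+1).*2.+3 by lia.
  have -> : j + r.*2.+2 + t.*2.+2 = j + (r + t.+1).*2.+2 by lia.
  apply=> [|s|//]; first by rewrite -addnS h4 h2 // negbK.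
  rewrite leqn0 => /eqP->; rewrite h2 // negbK -e; congr (c _); lia.
have := IH j r.+1 h1; have -> : r.+1 + t = r + t.+1 by lia.
apply=> s hs.
  have [->|hsr] := eqVneq s r.+1; last by apply: h2; lia.
  by move: ne; rewrite doubleS; case: (c _); case: (c j).
by have [->//|hsr] := eqVneq s r; apply: h3; lia.
Qed.

(* A repeated digit fixes the parity of the block decomposition from there on. *)
Lemma below_double_theta f c j : below (Phi f) c -> c j.+1 = ~~ c j ->
  c j.+2 = c j.+1 -> sdrop j.+2 c = theta (fun t => c (j.+2 + t.*2)).
Proof.
move=> Yc h1 h2; apply: theta_of_blocks => t; rewrite /sdrop.
have := below_blocks t Yc (j := j) (r := 0) h1; rewrite add0n.
have -> : j + t.*2.+3 = j.+2 + t.*2.+1 by lia.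
have -> : j + t.*2.+2 = j.+2 + t.*2 by lia.
by apply=> // s; rewrite leqn0 => /eqP->; rewrite addn2 h2 h1.
Qed.

(** * Desubstitution and rank *)

Lemma alternating_or_double (c : nat -> bool) i : c i.+1 = ~~ c i ->
  (forall t, c (i + t) = c i (+) odd t) \/
  exists j, [/\ i <= j, c j.+1 = ~~ c j & c j.+2 = c j.+1].
Proof.
move=> hi; have [h|/existsNP[k hk]] := pselect (forall t, c (i + t).+1 = ~~ c (i + t)).
  left; elim=> [|t IH]; first by rewrite addn0 addbF.
  by rewrite addnS h IH /= addbN.
right; have exk : exists k, c (i + k).+1 == c (i + k).
  by exists k; move: hk; case: (c _); case: (c _).
case: (ex_minnP exk) => -[|m] /eqP hm mmin; first by move: hm; rewrite addn0 hi; case: (c i).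
have him : c (i + m).+1 = ~~ c (i + m).
  have := mmin m; rewrite ltnn; case: eqP => [_ /(_ isT)//|].
  by case: (c _); case: (c _).
by exists (i + m); rewrite -?addnS in him hm *; split=> //; rewrite ?leq_addr ?addnS in hm *.
Qed.

Lemma below_theta_double f c j : below (Phi f) c -> c j.+1 = ~~ c j ->
  c j.+2 = c j.+1 ->
  exists2 e, sdrop j.+2 c = theta e & below f e.
Proof.
move=> Yc h1 h2; have h := below_double_theta Yc h1 h2.
by eexists; [exact: h|apply: below_theta; rewrite -h; exact: below_sdrop].
Qed.

Lemma not_constant (c : nat -> bool) :
  ~ (forall k, c k = c 0) -> exists i, c i.+1 = ~~ c i.
Proof.
move=> h; apply: contrapT => /forallNP h'; apply: h; elim=> // k <-.
by have := h' k; case: (c _); case: (c _).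
Qed.

(** After a change of digit, [c] either alternates forever, and is [theta] of a constant there, or
    repeats a digit, which fixes the blocks. *)
Lemma below_constant_or_theta f c : below (Phi f) c ->
  (forall k, c k = c 0) \/ exists i e, sdrop i c = theta e /\ below f e.
Proof.
move=> Yc; have [|/not_constant [i hi]] := pselect (forall k, c k = c 0); first by left.
right; have [h|[j [_ h1 h2]]] := alternating_or_double hi; last first.
  by have [e] := below_theta_double Yc h1 h2; exists j.+2, e.
have he : sdrop i c = theta (fun=> c i) by apply/funext => k; exact: h.
by exists i, (fun=> c i); split=> //; apply: (@below_theta f); rewrite -he; exact: below_sdrop.
Qed.

(** A prefix may be dropped only before a desubstitution: rank 0 means constant from the first digit
    on. *)
Fixpoint rank (m : nat) (c : nat -> bool) : Prop :=
  if m is m'.+1 then exists i e, sdrop i c = theta e /\ rank m' e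
  else forall k, c k = c 0.

Lemma below_alpha0 c : ~ below (alpha 0) c.
Proof. by move=> /(_ 0) [j []]. Qed.

(** Each desubstitution lowers the index of [alpha] by one, and nothing is below [alpha 0], the zero
    sequence. *)
Lemma below_alpha_rank N c : below (alpha N) c -> exists2 m, m < N & rank m c.
Proof.
elim: N c => [c /below_alpha0 //|N IH c] /below_constant_or_theta[h|[i [e [h /IH[m mN rm]]]]].
  by exists 0.
by exists m.+1 => //; exists i, e.
Qed.

Lemma theta_not_constant i c e : sdrop i c = theta e -> c i.+1 = ~~ c i.
Proof.
move=> h; have := congr1 (fun d => d 0) h; have := congr1 (fun d => d 1) h.
by rewrite /sdrop /theta addn0 addn1 /= => -> ->; case: (e 0).
Qed.

Lemma constant_rank m e : (forall k, e k = e 0) -> rank m e -> m = 0.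
Proof.
case: m => // m h [i [e' [/theta_not_constant]]].
by rewrite !h; case: (e 0).
Qed.

(** A long enough common prefix forces on [c'] the block structure of [c], so both can be
    desubstituted together until [c] becomes alternating or constant; there [c'] either coincides
    with it or admits a further desubstitution. *)
Lemma rank_jump m N c : below (alpha N) c -> rank m c ->
  exists L, forall c', below (alpha N) c' -> (forall k, k < L -> c' k = c k) ->
    c' = c \/ exists m', [/\ m < m', m' < N & rank m' c'].
Proof.
elim: m N c => [|m IH] [|N] c; do ?by move=> /below_alpha0.
  move=> Yc rc; exists 1 => c' Yc' hc'.
  have [h|[i [e [h /below_alpha_rank[m mN rm]]]]] := below_constant_or_theta Yc'.
    by left; apply/funext => k; rewrite h rc hc'.
  by right; exists m.+1; split=> //; exists i, e.
move=> Yc [i [e [h rm]]]; have {}rm : rank m e := rm.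
have Ye : below (alpha N) e.
  by apply: (@below_theta (alpha N)); rewrite -h; exact: below_sdrop.
have hi := theta_not_constant h.
have cE k : c (i + k) = theta e k by rewrite -h.
have [ec|/not_constant[t et]] := pselect (forall k, e k = e 0).
  have m0 := constant_rank ec rm; subst m.
  exists i.+2 => c' Yc' hc'.
  have hi' : c' i.+1 = ~~ c' i by rewrite !hc'.
  have [h'|[j [_ h1 h2]]] := alternating_or_double hi'.
    left; apply/funext => k; have [ki|ik] := ltnP k i; first by rewrite hc' //; lia.
    rewrite -(subnKC ik) h' cE hc' 1?ltnW// -[in c i](addn0 i) cE /theta ec.
    by rewrite [in RHS]ec addbF.
  right; have [e' he' /[dup] Ye' /below_alpha_rank[m mN rm']] := below_theta_double Yc' h1 h2.
  exists m.+1; split=> //; last by exists j.+2, e'.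
  (* For constant [e'] the tail of [c'] at [j] would be [Phi] of 1^oo, which is not below
     [Phi (alpha N)], as no sequence exceeds 1^oo. *)
  case: m mN rm' => // mN e'c.
  have c'E k : c' (j.+2 + k) = theta e' k by rewrite -he'.
  have e'0 : e' 0 = ~~ c' j by rewrite -h1 -h2 -[in RHS](addn0 j.+2) c'E /theta addbF.
  have [] // : ~ lexlt (Phi (fun=> true)) (Phi (alpha N)) by move=> /lexlt_Phi[l []].
  suff <- : rtail c' j = Phi (fun=> true) by exact: Yc'.
  apply/funext => -[|k]; rewrite /rtail /= ?addn1 ?h1; first by case: (c' j).
  by rewrite -addSnnS -addSnnS c'E /theta e'c e'0; case: (c' j).
have [Le hLe] := IH _ _ Ye rm.
(* The prefix shows the repeated digit at [i + t.*2.+1] and [i + t.*2.+2], which fixes the blocks of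
   [c'], and the first [Le] blocks. *)
exists (i + t.*2.+3 + Le.*2) => c' Yc' hc'.
have c'E k : k < t.*2.+3 + Le.*2 -> c' (i + k) = theta e k.
  by move=> hk; rewrite hc' ?cE //; lia.
have hblock u : c' (i + u.*2.+1) = ~~ c' (i + u.*2).
  have [ut|tu] := leqP u t; first by rewrite !c'E ?theta_even ?theta_odd //; lia.
  have h1 : c' (i + t.*2).+1 = ~~ c' (i + t.*2).
    by rewrite -addnS !c'E ?theta_even ?theta_odd //; lia.
  have h2 : c' (i + t.*2).+2 = c' (i + t.*2).+1.
    by rewrite -!addnS !c'E -?doubleS ?theta_even ?theta_odd //; lia.
  have := below_double_theta Yc' h1 h2.
  move=> /(congr1 (fun d => d (u - t.+1).*2.+1)); rewrite theta_odd /sdrop.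
  have -> : (i + t.*2).+2 + (u - t.+1).*2.+1 = i + u.*2.+1 by lia.
  by have -> : (i + t.*2).+2 + (u - t.+1).*2 = i + u.*2 by lia.
have he' := @theta_of_blocks (sdrop i c') hblock; move: he'.
set e' := (fun t => _) => he'.
have Ye' : below (alpha N) e'.
  by apply: (@below_theta (alpha N)); rewrite -he'; exact: below_sdrop.
have [k hk|ee'|[m' [mm' mN rm']]] := hLe e' Ye'.
- by rewrite /e' /sdrop c'E ?theta_even //; lia.
- left; apply/funext => k; have [ki|ik] := ltnP k i; first by rewrite hc' //; lia.
  by rewrite -(subnKC ik) cE -ee' -he'.
by right; exists m'.+1; split=> //; exists i, e'.
Qed.

(** * Tails that may equal the bound *)

Definition weakly_below (a c : nat -> bool) : Prop := forall i, ~ lexlt a (rtail c i).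

(** Tails starting inside a block desubstitute by [rtail_theta]. Those starting at a block boundary
    begin with 10 or 01, and the very first one with 0, whereas [Phi a] begins with 11. *)
Lemma weakly_below_Phi (a e : nat -> bool) : a 0 -> e 0 ->
  weakly_below a e -> weakly_below (Phi a) (Phi e).
Proof.
move=> a0 e0 h i.
have rtailS k : rtail (Phi e) k.+1 = rtail (theta e) k by [].
case: i => [|i].
  by move=> [[|j] [hj]] //; have := hj 0 isT; rewrite /= /rtail /= /theta /= e0.
rewrite rtailS -(odd_double_half i); case: (odd i); last first.
  by rewrite add0n rtail_theta lexlt_Phi.
rewrite add1n; set t := i./2.
have r0 : rtail (theta e) t.*2.+1 0 = ~~ (e t) (+) e t.+1.
  by rewrite /rtail theta_odd addn1 -doubleS theta_even.
have r1 : rtail (theta e) t.*2.+1 1 = ~~ (rtail (theta e) t.*2.+1 0).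
  by rewrite r0 /rtail theta_odd addn2 -doubleS theta_odd; case: (e t); case: (e t.+1).
move=> [[|[|j]] [hj h1 h2]] //; first by move: h1; rewrite /= /theta /= a0.
by have := hj 1 isT; rewrite r1 -(hj 0 isT) /= /theta /= a0.
Qed.

(** * Values of digit sequences *)

Local Open Scope classical_set_scope.
Local Open Scope ring_scope.

Definition qval (R : realType) (q : R) (d : nat -> bool) : R :=
  limn (series (fun i => (d i)%:R * q ^- i.+1)).

Lemma qexpansion_partial_le (R : realType) (q : R) (d : nat -> bool) n : 1 < q ->
  series (fun i => (d i)%:R * q ^- i.+1) n <= (q - 1)^-1 * (1 - q ^- n).
Proof.
move=> q1; have q0 : 0 < q by lra.
rewrite /series /=; elim: n => [|n IH].
  by rewrite big_geq // expr0 invr1 subrr mulr0.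
rewrite big_nat_recr //=; apply: le_trans (lerD IH (_ : _ <= q ^- n.+1)) _.
  by rewrite ler_piMl ?invr_ge0 ?exprn_ge0 ?(ltW q0) //; case: (d n) => /=.
rewrite le_eqVlt; apply/orP; left; apply/eqP; rewrite exprS; field.
by rewrite expf_neq0 ?gt_eqF ?subr_gt0.
Qed.

Lemma qval_cvg (R : realType) (q : R) (d : nat -> bool) : 1 < q -> is_qexpansion q (qval q d) d.
Proof.
move=> q1; have q0 : 0 < q by lra.
apply: nondecreasing_is_cvgn.
  by apply: nondecreasing_series => n _ _; rewrite mulr_ge0 // invr_ge0 exprn_ge0 // ltW.
exists (q - 1)^-1 => _ [n _ <-]; apply: le_trans (qexpansion_partial_le _ _ q1) _.
by rewrite ler_piMr ?invr_ge0 ?subr_ge0 ?(ltW q1) // gerBl invr_ge0 exprn_ge0 // ltW.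
Qed.

Lemma qexpansionP (R : realType) (q x : R) (d : nat -> bool) : 1 < q ->
  is_qexpansion q x d <-> qval q d = x.
Proof.
move=> q1; split=> [h|<-]; last exact: qval_cvg.
by apply: cvg_unique h; [exact: Rhausdorff|exact: qval_cvg].
Qed.

Lemma qval_ge0 (R : realType) (q : R) (d : nat -> bool) : 1 < q -> 0 <= qval q d.
Proof.
move=> q1; apply: limr_ge; first by apply/cvg_ex; exists (qval q d); exact: qval_cvg.
apply: nearW => n; rewrite /series /=; apply: sumr_ge0 => i _.
by rewrite mulr_ge0 // invr_ge0 exprn_ge0 //; lra.
Qed.

Lemma qval_le (R : realType) (q : R) (d : nat -> bool) : 1 < q -> qval q d <= (q - 1)^-1.
Proof.
move=> q1; apply: limr_le; first by apply/cvg_ex; exists (qval q d); exact: qval_cvg.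
apply: nearW => n; apply: le_trans (qexpansion_partial_le _ _ q1) _.
by rewrite ler_piMr ?invr_ge0 ?subr_ge0 ?(ltW q1) // gerBl invr_ge0 exprn_ge0 //; lra.
Qed.

Lemma qval_step (R : realType) (q : R) (d : nat -> bool) : 1 < q ->
  qval q d = ((d 0%N)%:R + qval q (sdrop 1 d)) / q.
Proof.
move=> q1; have q0 : q != 0 by rewrite gt_eqF //; lra.
apply/(qexpansionP _ _ q1); rewrite /is_qexpansion -cvg_shiftS /=.
have -> : (fun n => series (fun i => (d i)%:R * q ^- i.+1) n.+1) =
    (fun n => ((d 0%N)%:R + series (fun i => (sdrop 1 d i)%:R * q ^- i.+1) n) / q).
  apply/funext => n; rewrite /series /= big_nat_recl // expr1 mulrDl mulr_suml.
  congr (_ + _); apply: eq_bigr => i _.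
  by rewrite /sdrop /= [q ^+ i.+2]exprSr invfM mulrA.
by apply: cvgMr_tmp; apply: cvgD; [exact: cvg_cst|exact: qval_cvg].
Qed.

Lemma exists_geometric_lt (R : realType) (C l e : R) : 0 <= l < 1 -> 0 < e ->
  exists n, C * l ^+ n < e.
Proof.
move=> /andP[l0 l1] e0.
have /cvgrPdist_lt/(_ e e0) : geometric C l @ \oo --> 0 by apply: cvg_geometric; rewrite ger0_norm.
move=> [n _ /(_ n (leqnn n))]; rewrite /geometric /= sub0r normrN => h.
by exists n; apply: le_lt_trans h; exact: ler_norm.
Qed.

(** Iteration bounds [F d] by [C * l ^+ n] for every [n]. This proves relations between values one
    digit at a time, without manipulating series. *)
Lemma sdrop_contraction_le0 (R : realType) (F : (nat -> bool) -> R) (C l : R) :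
  0 <= l < 1 -> (forall d, F d <= C) -> (forall d, F d <= l * F (sdrop 1 d)) ->
  forall d, F d <= 0.
Proof.
move=> /[dup] hl /andP[l0 _] hC hF d; rewrite leNgt; apply/negP => F0.
have [n hn] := exists_geometric_lt C hl F0.
suff h : F d <= l ^+ n * C by have := le_lt_trans h; rewrite mulrC => /(_ _ hn); rewrite ltxx.
elim: n d {F0 hn} => [|n IH] d; first by rewrite expr0 mul1r.
by apply: le_trans (hF d) _; rewrite exprS -mulrA ler_wpM2l.
Qed.

Lemma sdrop_contraction_eq0 (R : realType) (F : (nat -> bool) -> R) (C l : R) :
  0 <= l < 1 -> (forall d, `|F d| <= C) -> (forall d, F d = l * F (sdrop 1 d)) ->
  forall d, F d = 0.
Proof.
move=> hl hC hF d; apply/eqP; rewrite eq_le.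
apply/andP; split; first by apply: (sdrop_contraction_le0 hl (C := C)) => {}d;
  [have := ler_norm (F d); have := hC d; lra|rewrite -hF].
rewrite -oppr_le0; apply: (sdrop_contraction_le0 hl (C := C) (F := fun d => - F d)) => {}d.
  by have := ler_norm (- F d); rewrite normrN; have := hC d; lra.
by rewrite mulrN -hF.
Qed.

Lemma invf_itv (R : realType) (q : R) : 1 < q -> 0 <= q^-1 < 1.
Proof. by move=> q1; rewrite invr_ge0 invf_lt1 ?q1 ?andbT; lra. Qed.

Lemma qval_norm (R : realType) (q : R) (d : nat -> bool) : 1 < q -> `|qval q d| <= (q - 1)^-1.
Proof. by move=> q1; rewrite ger0_norm ?qval_ge0 ?qval_le. Qed.

Lemma qval_neg (R : realType) (q : R) (d : nat -> bool) : 1 < q ->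
  qval q (neg d) = (q - 1)^-1 - qval q d.
Proof.
move=> q1; apply/eqP; rewrite -subr_eq0; apply/eqP.
apply: (sdrop_contraction_eq0 (F := fun d => qval q (neg d) - ((q - 1)^-1 - qval q d))
  (l := q^-1) (C := 3 * (q - 1)^-1)) => [|{}d|{}d]; first exact: invf_itv.
  apply: le_trans (ler_normB _ _) _.
  have := qval_norm (neg d) q1; have := ler_normB (q - 1)^-1 (qval q d).
  by have := qval_norm d q1; rewrite (ger0_norm (_ : 0 <= (q - 1)^-1)) ?invr_ge0; lra.
rewrite (qval_step d q1) (qval_step (neg d) q1).
have -> : sdrop 1 (neg d) = neg (sdrop 1 d) by [].
by rewrite /neg; case: (d 0%N) => /=; field; rewrite !gt_eqF //; lra.
Qed.

(** Block t, counted from 0, contributes (1 + (q - 1) d_t) / q^(2t+2), whence the base [q ^+ 2]. *)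
Lemma qval_theta (R : realType) (q : R) (d : nat -> bool) : 1 < q ->
  qval q (theta d) = (q - 1) * qval (q ^+ 2) d + (q ^+ 2 - 1)^-1.
Proof.
move=> q1; have q21 : 1 < q ^+ 2 by nra.
apply/eqP; rewrite -subr_eq0; apply/eqP.
apply: (sdrop_contraction_eq0 (l := (q ^+ 2)^-1)
  (F := fun d => qval q (theta d) - ((q - 1) * qval (q ^+ 2) d + (q ^+ 2 - 1)^-1))
  (C := (q - 1)^-1 + ((q - 1) * (q ^+ 2 - 1)^-1 + (q ^+ 2 - 1)^-1))) => [|{}d|{}d].
- exact: invf_itv.
- apply: le_trans (ler_normB _ _) _; apply: lerD; first exact: qval_norm.
  apply: le_trans (ler_normD _ _) _; apply: lerD.
    rewrite normrM ger0_norm; last lra.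
    by rewrite ler_wpM2l ?qval_norm //; lra.
  by rewrite ger0_norm // invr_ge0; lra.
rewrite (qval_step (theta d) q1) (qval_step (sdrop 1 (theta d)) q1) (qval_step d q21).
have -> : sdrop 1 (sdrop 1 (theta d)) = theta (sdrop 1 d).
  by apply/funext => k; rewrite /sdrop /theta /= negbK.
rewrite /sdrop /theta /=; case: (d 0%N) => /=; field; rewrite !gt_eqF //; nra.
Qed.

Lemma qval_Phi (R : realType) (q : R) (d : nat -> bool) : 1 < q ->
  qval q (Phi d) = (1 + (q - 1) * qval (q ^+ 2) d + (q ^+ 2 - 1)^-1) / q.
Proof.
move=> q1; rewrite qval_step // -addrA -qval_theta //.
Qed.

(** * Dependence of the value on the base *)

Lemma qval_le_base (R : realType) (q r : R) (d : nat -> bool) :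
  1 < q -> q <= r -> qval r d <= qval q d.
Proof.
move=> q1 qr; rewrite -subr_le0; have r1 : 1 < r by lra.
apply: (sdrop_contraction_le0 (F := fun d => qval r d - qval q d) (l := q^-1)
  (C := (r - 1)^-1)) => [|{}d|{}d]; first exact: invf_itv.
  by have := qval_le d r1; have := qval_ge0 d q1; lra.
rewrite (qval_step d r1) (qval_step d q1) -subr_ge0.
set a := qval r _; set b := qval q _; have a0 : 0 <= a by exact: qval_ge0.
have -> : q^-1 * (a - b) - (((d 0%N)%:R + a) / r - ((d 0%N)%:R + b) / q) =
   ((d 0%N)%:R + a) * (q^-1 - r^-1) by ring.
by apply: mulr_ge0; [rewrite addr_ge0 ?ler0n|rewrite subr_ge0 lef_pV2 ?posrE //; lra].
Qed.

Lemma qval_lt_base (R : realType) (q r : R) (d : nat -> bool) : 1 < q -> q < r -> d 0%N ->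
  qval r d < qval q d.
Proof.
move=> q1 qr d0; have r1 : 1 < r by lra.
rewrite (qval_step d r1) (qval_step d q1) d0.
apply: (@le_lt_trans _ _ ((1 + qval q (sdrop 1 d)) / r)).
  by rewrite ler_pM2r ?invr_gt0 ?lerD2l ?qval_le_base //; lra.
have h := qval_ge0 (sdrop 1 d) q1.
by rewrite ltr_pM2l ?ltf_pV2 ?posrE //; lra.
Qed.

(** Monotonicity for the complement of [d]: no sequence varies more than 1^oo, which reduces
    continuity to that of 1/(q-1). *)
Lemma qval_base_dist (R : realType) (q r : R) (d : nat -> bool) : 1 < q -> q <= r ->
  qval q d - qval r d <= (q - 1)^-1 - (r - 1)^-1.
Proof.
move=> q1 qr; have := qval_le_base (neg d) q1 qr.
by rewrite !qval_neg //; lra.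
Qed.

Lemma qval_continuous (R : realType) (d : nat -> bool) (q : R) : 1 < q ->
  {for q, continuous (fun r : R => qval r d)}.
Proof.
move=> q1; apply/cvgrPdist_lt => e e0.
have : (fun r : R => (r - 1)^-1) @ q --> (q - 1)^-1.
  by apply: cvgV; [rewrite subr_eq0 gt_eqF|apply: cvgB; [exact: cvg_id|exact: cvg_cst]].
move=> /cvgrPdist_lt/(_ e e0) h; near=> r.
have r1 : 1 < r by near: r; exact: lt_nbhsr.
apply: le_lt_trans (near h r _) => //; have [qr|/ltW rq] := leP q r.
  rewrite !ger0_norm ?subr_ge0 ?qval_le_base ?qval_base_dist // lef_pV2 ?posrE; lra.
rewrite distrC [leRHS]distrC !ger0_norm ?subr_ge0 ?qval_le_base ?qval_base_dist //.
by rewrite lef_pV2 ?posrE; lra.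
Unshelve. all: by end_near. Qed.

(** * Unique expansions *)

Lemma rtail0 (c : nat -> bool) :
  rtail c 0 = if c 0%N then neg (sdrop 1 c) else sdrop 1 c.
Proof. by apply/funext => k; rewrite /rtail; case: (c 0%N). Qed.

Lemma rtail_neg (c : nat -> bool) i : rtail (neg c) i = rtail c i.
Proof. by apply/funext => k; rewrite /rtail /neg; case: (c _); case: (c _). Qed.

Lemma lexlt_total (s t : nat -> bool) : [\/ lexlt s t, s = t | lexlt t s].
Proof.
have [h|/existsNP[k hk]] := pselect (forall k, s k = t k).
  by apply: Or32; apply/funext.
have exk : exists k, s k != t k by exists k; apply/eqP.
case: (ex_minnP exk) => j hj jmin.
have h i : (i < j)%N -> s i = t i.
  by move=> ij; apply/eqP; apply: contraTT ij => /jmin; rewrite -leqNgt.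
move: hj; case sj: (s j); case tj: (t j) => // _; [apply: Or33|apply: Or31].
  by exists j; split=> // i /h.
by exists j.
Qed.

Lemma sdropS n d : sdrop n.+1 d = sdrop 1 (sdrop n d).
Proof. by apply/funext => k; rewrite /sdrop; congr (d _); lia. Qed.

(** Greedy algorithm: [g n] is the rescaled remainder after [n] digits. It stays in the interval
    because [q <= 2] gives 1 <= 1/(q-1), so the error [e 0] is at most a constant times q^-n for
    every n. *)
Lemma qval_surj (R : realType) (q y : R) : 1 < q <= 2 -> 0 <= y <= (q - 1)^-1 ->
  exists d, qval q d = y.
Proof.
move=> /andP[q1 q2] hy; have q0 : 0 < q by lra.
pose g := fix g (n : nat) : R := if n is n'.+1 then q * g n' - (q^-1 <= g n')%R%:R else y.
pose d n : bool := q^-1 <= g n.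
have hqq : q * q^-1 = 1 by rewrite divff ?gt_eqF.
have hm : (q - 1) * (q - 1)^-1 = 1 by rewrite divff // gt_eqF // subr_gt0.
have hg n : 0 <= g n <= (q - 1)^-1.
  elim: n => [//|n /andP[g0 g1]] /=; case: (leP q^-1 (g n)) => /= hn; apply/andP.
    have := ler_wpM2l (ltW q0) hn; have := ler_wpM2l (ltW q0) g1.
    by split; lra.
  have : 1 <= (q - 1)^-1 by rewrite -invr1 lef_pV2 ?posrE; lra.
  have := ler_wpM2l (ltW q0) (ltW hn); have := mulr_ge0 (ltW q0) g0.
  by split; lra.
pose e n := qval q (sdrop n d) - g n.
have he n : e n = q^-1 * e n.+1.
  rewrite /e (sdropS n d) (qval_step (sdrop n d) q1) /= -/(d n).
  by rewrite /sdrop addn0; field; rewrite gt_eqF.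
have hen n : e 0%N = q^-1 ^+ n * e n.
  by elim: n => [|n ->]; rewrite ?expr0 ?mul1r // exprSr -mulrA -he.
exists d; apply/eqP; rewrite -subr_eq0 -normr_eq0 eq_le normr_ge0 andbT leNgt.
apply/negP => h0.
have [n] := exists_geometric_lt (2 * (q - 1)^-1) (invf_itv q1) h0.
have -> : qval q d - y = e 0%N by [].
rewrite (hen n) normrM ger0_norm ?exprn_ge0 ?invr_ge0 ?(ltW q0) //.
rewrite mulrC ltr_pM2l ?exprn_gt0 ?invr_gt0 //; apply/negP; rewrite -leNgt.
apply: le_trans (ler_normB _ _) _; have /andP[g0 g1] := hg n.
by rewrite (ger0_norm g0); have := qval_norm (sdrop n d) q1; lra.
Qed.

Definition univoque (R : realType) (q : R) (c : nat -> bool) : Prop :=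
  forall c', qval q c' = qval q c -> c' = c.

Lemma univoque_sdrop (R : realType) (q : R) (c : nat -> bool) i : 1 < q ->
  univoque q c -> univoque q (sdrop i c).
Proof.
move=> q1; elim: i c => [|i IH] c hc.
  by have -> : sdrop 0 c = c by [].
have -> : sdrop i.+1 c = sdrop i (sdrop 1 c) by [].
apply: IH => d hd; have h : scons (c 0%N) d = c.
  apply: hc; rewrite (qval_step c q1) (qval_step (scons _ _) q1) -hd.
  by congr ((_ + qval q _) / _).
by rewrite -h.
Qed.

(** If the tail after a digit 0 had value at least 1, the digit could be raised to 1 and the tail
    replaced by an expansion of its value minus 1; a digit 1 is symmetric. *)
Lemma univoque_rtail_lt (R : realType) (q : R) (c : nat -> bool) i : 1 < q <= 2 ->
  univoque q c -> qval q (rtail c i) < 1.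
Proof.
move=> /[dup] q12 /andP[q1 q2] /(univoque_sdrop (i := i) q1).
have -> : rtail c i = rtail (sdrop i c) 0 by rewrite rtail_sdrop addn0.
move: {c i}(sdrop i c) => c hc; rewrite ltNge; apply/negP => h.
have [|g hg] := @qval_surj R q (qval q (rtail c 0) - 1) q12.
  by have := qval_le (rtail c 0) q1; lra.
pose c' := scons (~~ c 0%N) (if c 0%N then neg g else g).
suff : c' = c by move=> /(congr1 (fun d => d 0%N)) /=; case: (c 0%N).
apply: hc; rewrite (qval_step c q1) (qval_step c' q1) /c' /=; congr (_ / q).
have -> : sdrop 1 c' = if c 0%N then neg g else g by [].
move: hg; rewrite rtail0; case: (c 0%N) => /= hg; last by rewrite hg; ring.
by rewrite qval_neg // hg qval_neg //; ring.
Qed.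

(** Every digit is forced: the other choice would need a next tail of value below 0 or above
    1/(q-1). *)
Lemma rtail_lt_univoque (R : realType) (q : R) (c : nat -> bool) : 1 < q ->
  (forall i, qval q (rtail c i) < 1) -> univoque q c.
Proof.
move=> q1 hc c' hc'; apply/funext => i.
have head (d d' : nat -> bool) :
    qval q (rtail d 0) < 1 -> qval q d' = qval q d -> d' 0%N = d 0%N.
  rewrite (qval_step d q1) (qval_step d' q1) rtail0 => h.
  have qn0 : q != 0 by rewrite gt_eqF //; lra.
  move=> /(mulIf (invr_neq0 qn0)); have := qval_le (sdrop 1 d') q1.
  have := qval_ge0 (sdrop 1 d') q1; move: h.
  by case: (d 0%N); case: (d' 0%N) => //=; rewrite ?qval_neg //; lra.
have h n : qval q (sdrop n c') = qval q (sdrop n c).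
  elim: n => [//|n IH].
  have h0 : sdrop n c' 0%N = sdrop n c 0%N.
    by apply: head IH; rewrite rtail_sdrop addn0.
  have qn0 : q != 0 by rewrite gt_eqF //; lra.
  move: IH; rewrite (sdropS n c') (sdropS n c)
    (qval_step (sdrop n c') q1) (qval_step (sdrop n c) q1) h0.
  by move=> /(mulIf (invr_neq0 qn0)) /addrI.
have := head (sdrop i c) (sdrop i c'); rewrite rtail_sdrop /sdrop !addn0.
by apply; [exact: hc|exact: h].
Qed.

Lemma qval_lexlt_le (R : realType) (q : R) (s t : nat -> bool) j : 1 < q ->
  (forall i, (i < j)%N -> s i = t i) -> s j = false -> t j = true ->
  qval q s - qval q t <= q^-1 ^+ j.+1 * (qval q (rtail s j) - 1).
Proof.
move=> q1; have q0 : 0 < q by lra.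
elim: j s t => [|j IH] s t hst sj tj.
  rewrite (qval_step s q1) (qval_step t q1) sj tj rtail0 sj expr1.
  have := qval_ge0 (sdrop 1 t) q1.
  have iq : 0 < q^-1 by rewrite invr_gt0.
  set a := qval q (sdrop 1 s); set b := qval q (sdrop 1 t) => hb /=.
  by have := mulr_ge0 (ltW iq) hb; lra.
have := IH (sdrop 1 s) (sdrop 1 t) (fun i ij => hst i.+1 ij) sj tj.
rewrite rtail_sdrop add1n (qval_step s q1) (qval_step t q1) hst // => h.
by rewrite exprS -[leRHS]mulrA -mulrBl opprD addrACA subrr add0r mulrC ler_pM2l // invr_gt0.
Qed.

Lemma rtail_lt_below (R : realType) (q : R) (a c : nat -> bool) : 1 < q -> 1 <= qval q a ->
  (forall i, qval q (rtail c i) < 1) -> below a c.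
Proof.
move=> q1 ha hc i; have [//|e|[j [hj h0 h1]]] := lexlt_total (rtail c i) a.
  by have := hc i; rewrite e ltNge ha.
(* Complementing makes the tail of [c] the smaller sequence, so the bound involves a later tail of
   [c], whose value is below 1. *)
have := @qval_lexlt_le R q (neg (rtail c i)) (neg a) j q1.
rewrite rtail_neg rtail_rtail !qval_neg // /neg => /(_ _ _ _)/wrap[].
- by move=> k /hj ->.
- by rewrite h1.
- by rewrite h0.
have := hc (i + j.+1)%N; have := hc i.
have : 0 < q^-1 ^+ j.+1 by rewrite exprn_gt0 // invr_gt0; lra.
by nra.
Qed.

(** A tail equals [a], or by [qval_lexlt_le] its excess over [a] in value is at most a power of 1/q
    times the excess of a later tail. Iterating, no excess is positive. *)
Lemma weakly_below_rtail_lt (R : realType) (q : R) (a c : nat -> bool) : 1 < q -> qval q a < 1 ->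
  weakly_below a c -> forall i, qval q (rtail c i) < 1.
Proof.
move=> q1 ha hc; have [iq0 iq1] := andP (invf_itv q1).
have C0 : 0 <= (q - 1)^-1 by rewrite invr_ge0; lra.
have claim n : forall i, qval q (rtail c i) - qval q a <= (q - 1)^-1 * q^-1 ^+ n.
  elim: n => [|n IH] i.
    by rewrite expr0 mulr1; have := qval_le (rtail c i) q1; have := qval_ge0 a q1; lra.
  have [[j [hj h0 h1]]|->|/hc //] := lexlt_total (rtail c i) a; last first.
    by rewrite subrr mulr_ge0 // exprn_ge0.
  apply: le_trans (qval_lexlt_le q1 hj h0 h1) _; rewrite rtail_rtail.
  have := IH (i + j.+1)%N; set b := qval q (rtail _ _); set Z := _ * q^-1 ^+ n => hb.
  have Z0 : 0 <= Z by rewrite mulr_ge0 // exprn_ge0.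
  apply: (@le_trans _ _ (q^-1 ^+ j.+1 * Z)).
    by rewrite ler_wpM2l ?exprn_ge0 //; lra.
  rewrite [q^-1 ^+ n.+1]exprSr mulrA -/Z mulrC ler_wpM2l // exprS ler_piMr // exprn_ile1 //; lra.
move=> i; rewrite ltNge; apply/negP => hi.
have ha' : 0 < 1 - qval q a by lra.
have [n hn] := exists_geometric_lt (q - 1)^-1 (invf_itv q1) ha'.
by have := claim n i; lra.
Qed.

Lemma univoque_basesP (R : realType) (x q : R) :
  univoque_bases x q <-> 1 < q <= 2 /\ exists2 c, qval q c = x & univoque q c.
Proof.
split=> -[/[dup] q12 /andP[q1 q2]] => [[c [/(qexpansionP _ _ q1) hc hu]]|[c hc hu]].
  by split=> //; exists c => // c'; rewrite hc => /(qexpansionP _ _ q1)/hu ->.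
split=> //; exists c; split; first exact/qexpansionP.
by move=> c' /(qexpansionP _ _ q1); rewrite -hc => /hu.
Qed.

(** * Values of the substituted sequences *)

Definition ones_then_cycle (k : nat) : nat -> bool := iter k (scons true) (alpha 1).

Lemma alphaS m : alpha m.+1 = iter m Phi (alpha 1).
Proof. by rewrite /alpha iterSr. Qed.

Lemma alpha1E k : alpha 1 k = ~~ odd k.
Proof. by case: k => //= k; rewrite /theta /= negbK. Qed.

Lemma lexlt_irr s : ~ lexlt s s.
Proof. by move=> [j [_ ->]]. Qed.

Lemma weakly_below_ones_then_cycle k : weakly_below (alpha 1) (ones_then_cycle k).
Proof.
elim: k => [|k IH] i.
  have -> : rtail (ones_then_cycle 0) i = alpha 1; last exact: lexlt_irr.
  apply/funext => j; rewrite /rtail /ones_then_cycle /iter !alpha1E oddD /=.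
  by case: (odd i); case: (odd j).
case: i => [[[|j] [h]]|i]; last exact: IH.
  by rewrite alpha1E.
by have := h 0%N isT; rewrite /rtail alpha1E; case: k {IH h}.
Qed.

Lemma head_iter_Phi m (e : nat -> bool) : e 0%N -> iter m Phi e 0%N.
Proof. by case: m. Qed.

Lemma head_ones_then_cycle k : ones_then_cycle k 0%N.
Proof. by case: k. Qed.

Lemma weakly_below_iter_Phi m k :
  weakly_below (alpha m.+1) (iter m Phi (ones_then_cycle k)).
Proof.
rewrite alphaS; elim: m => [|m IH]; first exact: weakly_below_ones_then_cycle.
by apply: weakly_below_Phi IH; apply: head_iter_Phi => //; exact: head_ones_then_cycle.
Qed.

Lemma qval_false (R : realType) (q : R) : 1 < q -> qval q (fun=> false) = 0.
Proof.
move=> q1; have := qval_step (fun=> false) q1.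
have -> : sdrop 1 (fun=> false) = (fun=> false) by [].
rewrite add0r => /eqP; rewrite -subr_eq0 -{1}[qval q _]mulr1 -mulrBr mulf_eq0.
have h : q^-1 < 1 by have /andP[] := invf_itv q1.
by rewrite [X in _ || X]gt_eqF ?orbF ?subr_gt0 // => /eqP.
Qed.

Lemma qval_true (R : realType) (q : R) : 1 < q -> qval q (fun=> true) = (q - 1)^-1.
Proof. by move=> q1; have := qval_neg (fun=> false) q1; rewrite qval_false // subr0. Qed.

Lemma qval_alpha1 (R : realType) (q : R) : 1 < q -> qval q (alpha 1) = q / (q ^+ 2 - 1).
Proof.
move=> q1; rewrite (qval_Phi _ q1) qval_false; last by nra.
by field; rewrite !gt_eqF //; nra.
Qed.

Lemma qval_ones_then_cycle (R : realType) (q : R) k : 1 < q ->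
  qval q (ones_then_cycle k) - qval q (alpha 1) = (1 - q^-1 ^+ k) / (q ^+ 2 - 1).
Proof.
move=> q1; have q0 : q ^+ 2 - 1 != 0 by rewrite gt_eqF //; nra.
have q0' : q != 0 by rewrite gt_eqF //; lra.
elim: k => [|k]; first by rewrite subrr expr0 subrr mul0r.
rewrite (qval_step (ones_then_cycle k.+1) q1) /=.
have -> : sdrop 1 (ones_then_cycle k.+1) = ones_then_cycle k by [].
move=> /eqP; rewrite subr_eq => /eqP ->; rewrite qval_alpha1 // [q^-1 ^+ k.+1]exprS.
by move: (q^-1 ^+ k) => t /=; field; rewrite q0 q0'.
Qed.

Lemma qval_alpha2 (R : realType) (q : R) : 1 < q ->
  qval q (alpha 2) - qval q (alpha 1) = (q ^+ 2 - q) / (q ^+ 4 - 1).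
Proof.
move=> q1; have q2 : 1 < q ^+ 2 by nra.
rewrite (qval_Phi (alpha 1) q1) !qval_alpha1 // -exprM.
by field; rewrite !gt_eqF //; nra.
Qed.

(* With Q = q ^ (2 ^ m), [tm_gap m q] is the value in base q of
   [iter m Phi 1^oo] minus that of [alpha m.+1]. *)
Definition tm_prod (R : realType) (m : nat) (q : R) : R :=
  \prod_(j < m) (1 - (q ^+ (2 ^ j))^-1).

Definition tm_gap (R : realType) (m : nat) (q : R) : R :=
  tm_prod m q / ((q ^+ (2 ^ m)) ^+ 2 - 1).

Lemma exprn2_gt1 (R : realType) m (q : R) : 1 < q -> 1 < q ^+ (2 ^ m).
Proof. by move=> q1; rewrite exprn_egt1 // expn_eq0. Qed.

Lemma exprn2S (R : realType) m (q : R) : (q ^+ (2 ^ m)) ^+ 2 = q ^+ (2 ^ m.+1).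
Proof. by rewrite -exprM expnSr. Qed.

(** By [qval_Phi], each [Phi] scales a difference of values by 1 - 1/q and squares the base. *)
Lemma qval_iter_Phi (R : realType) m (q : R) a b : 1 < q ->
  qval q (iter m Phi a) - qval q (iter m Phi b) =
  tm_prod m q * (qval (q ^+ (2 ^ m)) a - qval (q ^+ (2 ^ m)) b).
Proof.
move=> q1; elim: m a b => [|m IH] a b; first by rewrite /tm_prod big_ord0 mul1r.
rewrite 2!iterSr IH /tm_prod big_ord_recr /= -exprn2S.
have Q1 := exprn2_gt1 m q1; set Q := q ^+ (2 ^ m) in Q1 *.
rewrite -mulrA; congr (_ * _); rewrite !qval_Phi //.
by field; rewrite !gt_eqF //; nra.
Qed.

Lemma tm_prod_gt0 (R : realType) m (q : R) : 1 < q -> 0 < tm_prod m q.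
Proof.
move=> q1; apply: prodr_gt0 => j _.
by have /andP[] := invf_itv (exprn2_gt1 j q1); rewrite subr_gt0.
Qed.

Lemma tm_gap_gt0 (R : realType) m (q : R) : 1 < q -> 0 < tm_gap m q.
Proof.
move=> q1; rewrite divr_gt0 ?tm_prod_gt0 //.
by have := exprn2_gt1 m q1; nra.
Qed.

Lemma tm_gapS (R : realType) m (q : R) : 1 < q -> let Q := q ^+ (2 ^ m) in
  tm_gap m.+1 q = tm_gap m q * ((Q - 1) / (Q * (Q ^+ 2 + 1))).
Proof.
move=> q1 Q; have Q1 : 1 < Q by exact: exprn2_gt1.
rewrite /tm_gap /tm_prod big_ord_recr /= -exprn2S -/Q.
have Q2 : 1 < Q ^+ 2 by nra.
have Q4 : 1 < Q ^+ 4 by rewrite exprn_egt1.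
by field; do ?[apply/andP; split]; rewrite gt_eqF //; lra.
Qed.

Lemma tm_gap_le (R : realType) m (q : R) : 1 < q ->
  tm_gap m q <= tm_gap 0 q * 2^-1 ^+ m.
Proof.
move=> q1; elim: m => [|m IH]; first by rewrite expr0 mulr1.
rewrite tm_gapS // [2^-1 ^+ m.+1]exprSr [leRHS]mulrA; have Q1 := exprn2_gt1 m q1.
set Q := q ^+ (2 ^ m) in Q1 *; have d0 : 0 < Q * (Q ^+ 2 + 1) by nra.
apply: ler_pM; [by rewrite ltW // tm_gap_gt0|by rewrite divr_ge0; lra|exact: IH|].
by rewrite ler_pdivrMr //; nra.
Qed.

(** The factor (Q - 1) / (Q (Q^2 + 1)) of [tm_gapS] still increases near Q = 8/5, so index 1 is
    treated in closed form; later factors have Q >= q^2 >= 5/2, where it decreases. *)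
Lemma tm_gap_anti (R : realType) m (q r : R) : 8 / 5 <= q -> q <= r ->
  tm_gap m r <= tm_gap m q.
Proof.
move=> q85 qr; have q1 : 1 < q by lra. have r1 : 1 < r by lra.
have g0 : tm_gap 0 r <= tm_gap 0 q.
  rewrite /tm_gap /tm_prod !big_ord0 !div1r expn0 !expr1 lef_pV2 ?posrE; nra.
case: m => // m; elim: m => [|m IH].
  rewrite !tm_gapS // expn0 !expr1 /tm_gap /tm_prod !big_ord0 expn0 !expr1 !div1r.
  have E (s : R) : 1 < s ->
      (s ^+ 2 - 1)^-1 * ((s - 1) / (s * (s ^+ 2 + 1))) = (s * (s + 1) * (s ^+ 2 + 1))^-1.
    move=> s1; have s2 : 1 < s ^+ 2 by nra.
    by field; do ?[apply/andP; split]; rewrite gt_eqF //; lra.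
  have q2 : 0 <= q ^+ 2 by rewrite sqr_ge0.
  have r2 : 0 <= r ^+ 2 by rewrite sqr_ge0.
  have qr2 : q ^+ 2 <= r ^+ 2 by rewrite lerXn2r // nnegrE; lra.
  rewrite !E // lef_pV2 ?posrE ?mulr_gt0 //; try lra.
  by apply: ler_pM; rewrite ?mulr_ge0 ?ler_pM //; lra.
rewrite [leLHS]tm_gapS // [leRHS]tm_gapS //.
have h : (q ^+ (2 ^ m.+1)) <= (r ^+ (2 ^ m.+1)) by rewrite lerXn2r // nnegrE; lra.
have hq : 5 / 2 <= q ^+ (2 ^ m.+1).
  rewrite -exprn2S -exprM mulnC exprM; apply: (@le_trans _ _ (q ^+ 2)); first by nra.
  by rewrite ler_eXnr ?expn_gt0 //; nra.
set Q := q ^+ _ in h hq *; set S := r ^+ _ in h hq *.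
apply: ler_pM => //; first by rewrite ltW // tm_gap_gt0.
  by rewrite divr_ge0; nra.
rewrite ler_pdivrMr; last nra; rewrite mulrAC ler_pdivlMr; last nra.
rewrite -subr_ge0.
have -> : (Q - 1) * (S * (S ^+ 2 + 1)) - (S - 1) * (Q * (Q ^+ 2 + 1)) =
  (S - Q) * (Q * S * (S + Q) - (S ^+ 2 + S * Q + Q ^+ 2) - 1) by ring.
apply: mulr_ge0; first lra.
have a1 : 0 <= (Q - 5 / 2) * S ^+ 2 by rewrite mulr_ge0 ?sqr_ge0 //; lra.
have a2 : 0 <= (S - 5 / 2) * Q ^+ 2 by rewrite mulr_ge0 ?sqr_ge0 //; lra.
have a3 := sqr_ge0 (S - Q); have a4 : 1 <= Q ^+ 2 by nra.
by nra.
Qed.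

(** Up to gap factors, the left side is the excess over 1 of the sequence with k+2 ones in the
    larger base, the right side that with k+1 ones in the smaller. In the induction the left side
    grows by no more than the right. *)
Lemma overlap (R : realType) (q r : R) k : 8 / 5 <= q -> q <= r ->
  (r + 1) / (r ^+ 2 + 1) - r^-1 ^+ k.+2 <= 1 - q^-1 ^+ k.+1.
Proof.
move=> q85 qr; have v0 : 0 < q^-1 by rewrite invr_gt0; lra.
have u0 : 0 < r^-1 by rewrite invr_gt0; lra.
have uv : r^-1 <= q^-1 by rewrite lef_pV2 ?posrE; lra.
have v58 : q^-1 <= 5 / 8 by rewrite -[leRHS]invrK invf_div lef_pV2 ?posrE; lra.
elim: k => [|k IH].
  apply: (@le_trans _ _ (3 / 8)); last by rewrite expr1; lra.
  have -> : (r + 1) / (r ^+ 2 + 1) - r^-1 ^+ 2 =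
      3 / 8 - (3 * r ^+ 4 - 8 * r ^+ 3 + 3 * r ^+ 2 + 8) / (8 * r ^+ 2 * (r ^+ 2 + 1)).
    by field; rewrite !gt_eqF //; nra.
  rewrite gerBl divr_ge0 //; last by nra.
  (* The quartic is 3 times the first square plus 2/3 of the second plus 5/4. *)
  have := sqr_ge0 (r ^+ 2 - 4 / 3 * r - 1 / 2); have := sqr_ge0 (r - 3).
  by nra.
have step : r^-1 ^+ k.+2 * (1 - r^-1) <= q^-1 ^+ k.+1 * (1 - q^-1).
  set u := r^-1 in u0 uv *; set v := q^-1 in v0 uv v58 *.
  have huv : u ^+ 2 * (1 - u) <= v ^+ 2 * (1 - v).
    rewrite -subr_ge0.
    have -> : v ^+ 2 * (1 - v) - u ^+ 2 * (1 - u) =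
      (v - u) * (v * (1 - v - u) + u * (1 - u)) by ring.
    by apply: mulr_ge0; nra.
  have -> : u ^+ k.+2 * (1 - u) = u ^+ k * (u ^+ 2 * (1 - u)) by rewrite mulrA -exprD addn2.
  apply: (@le_trans _ _ (v ^+ k * (v ^+ 2 * (1 - v)))).
    apply: ler_pM => //; first by rewrite exprn_ge0 // ltW.
      by rewrite mulr_ge0 ?sqr_ge0 //; lra.
    by rewrite lerXn2r // nnegrE ltW.
  rewrite [v ^+ k.+1]exprSr -[leRHS]mulrA ler_pM2l ?exprn_gt0 //.
  by rewrite expr2 -mulrA ler_pM2l // ler_piMl; lra.
by move: step IH; rewrite [r^-1 ^+ k.+3]exprSr [q^-1 ^+ k.+2]exprSr; lra.
Qed.

Lemma qval_IVT (R : realType) (a b y : R) d : 1 < a -> a <= b ->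
  qval b d <= y <= qval a d -> exists2 q, a <= q <= b & qval q d = y.
Proof.
move=> a1 ab hy; have hab := qval_le_base d a1 ab.
have [||q] := @IVT R (fun q => qval q d) a b y ab.
- apply: continuous_in_subspaceT => q; rewrite inE /= in_itv /= => /andP[aq _].
  by apply: qval_continuous; lra.
- by rewrite min_r // max_l.
by rewrite in_itv /= => hq hqy; exists q.
Qed.

Lemma qval_alphaS_lt (R : realType) m (q : R) : 1 < q ->
  qval q (alpha m.+1) < qval q (alpha m.+2).
Proof.
move=> q1; have Q1 := exprn2_gt1 m q1.
have -> : alpha m.+2 = iter m Phi (alpha 2) by rewrite /alpha -iterD addn2.
rewrite alphaS -subr_gt0 qval_iter_Phi // mulr_gt0 ?tm_prod_gt0 // qval_alpha2 //.
rewrite divr_gt0 // subr_gt0; first by nra.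
by rewrite exprn_egt1.
Qed.

(** At 8/5, just below the golden ratio, [alpha 1] already has value at least 1, and values grow
    with the index; in base 2 no value exceeds 1. *)
Lemma alpha_base (R : realType) m :
  exists q : R, 8 / 5 <= q <= 2 /\ qval q (alpha m.+1) = 1.
Proof.
have h (n : nat) : 1 <= qval (8 / 5 : R) (alpha n.+1).
  elim: n => [|n IH].
    by rewrite qval_alpha1; [rewrite ler_pdivlMr; lra|lra].
  by apply: le_trans IH _; rewrite ltW // qval_alphaS_lt //; lra.
have [|||q hq hq1] := @qval_IVT R (8 / 5) 2 1 (alpha m.+1); [lra|lra| |by exists q].
rewrite h andbT; have h2 : 1 < 2 :> R by lra.
by apply: le_trans (qval_le _ h2) _; rewrite addrK invr1.
Qed.

(** * Isolated points *)

Lemma exists_univoque_below_alpha (R : realType) (x : R) : 1 < x ->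
  exists N (p : R) c, [/\ 1 < p <= 2, univoque p c, qval p c = x & 1 < qval p (alpha N)].
Proof.
(* [q m] is q_(m+1) of the overview. *)
move=> x1; have /choice[q hq] := @alpha_base R.
have q85 m : 8 / 5 <= q m by have [/andP[]] := hq m.
have q2 m : q m <= 2 by have [/andP[]] := hq m.
have qa m : qval (q m) (alpha m.+1) = 1 by have [] := hq m.
have q1 m : 1 < q m by have := q85 m; lra.
have qS m : q m < q m.+1.
  rewrite ltNge; apply/negP => h; have := qval_le_base (alpha m.+2) (q1 m.+1) h.
  by have := qval_alphaS_lt m (q1 m); rewrite !qa; lra.
have exn : exists n, tm_gap n (q n) <= x - 1.
  have hx : 0 < x - 1 by lra.
  have h2 : 0 <= (2^-1 : R) < 1 by lra.
  have [n hn] := exists_geometric_lt (tm_gap 0 (8 / 5)) h2 hx.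
  exists n; apply: le_trans (tm_gap_anti n (lexx _) (q85 n)) _.
  by apply: ltW; apply: le_lt_trans hn; apply: tm_gap_le; lra.
(* If the least index is 0, then [x] is at least the golden ratio [q 0], and 1^oo has value [x] in
   base 1 + 1/x. *)
case: (ex_minnP exn) => -[|m] gapx gapmin.
  have e0 : q 0%N ^+ 2 - 1 = q 0%N.
    have := qa 0%N; rewrite qval_alpha1 // => h.
    have h0 : q 0%N ^+ 2 - 1 != 0 by rewrite gt_eqF //; have := q1 0%N; nra.
    by have := congr1 (fun t => t * (q 0%N ^+ 2 - 1)) h; rewrite divfK // mul1r.
  have hx : (q 0%N)^-1 <= x - 1.
    by move: gapx; rewrite /tm_gap /tm_prod big_ord0 expn0 expr1 e0 div1r.
  have qq : (q 0%N)^-1 = q 0%N - 1.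
    have q00 : q 0%N != 0 by rewrite gt_eqF //; have := q1 0%N; lra.
    by apply: (mulfI q00); rewrite mulfV // mulrBr mulr1 -expr2; move: e0; lra.
  have xq : x^-1 <= (q 0%N)^-1 by rewrite lef_pV2 ?posrE; have := q1 0%N; lra.
  have x0 : 0 < x^-1 by rewrite invr_gt0; lra.
  have p1 : 1 < 1 + x^-1 by lra.
  have pq : 1 + x^-1 <= q 0%N by lra.
  exists 2%N, (1 + x^-1), (fun=> true); split.
  - by rewrite p1; have := q2 0%N; lra.
  - apply: rtail_lt_univoque => // i.
    have -> : rtail (fun=> true) i = (fun=> false) by [].
    by rewrite qval_false.
  - by rewrite qval_true // addrAC subrr add0r invrK.
  by have := qval_le_base (alpha 1) p1 pq; have := qval_alphaS_lt 0 p1; rewrite qa; lra.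
have xgap : x - 1 < tm_gap m (q m).
  by rewrite ltNge; apply/negP => /gapmin; rewrite ltnn.
set Q := q m ^+ (2 ^ m); have Q1 : 1 < Q by exact: exprn2_gt1.
have val0 k : qval (q m) (iter m Phi (ones_then_cycle k)) =
    1 + tm_gap m (q m) * (1 - Q^-1 ^+ k).
  apply/eqP; rewrite -subr_eq0 opprD addrA subr_eq0 -{1}(qa m) alphaS.
  rewrite qval_iter_Phi // qval_ones_then_cycle // /tm_gap -/Q; apply/eqP; ring.
(* These values increase from 1 to 1 + [tm_gap m (q m)], which exceeds [x] by minimality of the
   index; the least such [k] is taken. *)
have exk : exists k, x < qval (q m) (iter m Phi (ones_then_cycle k)).
  have hx : 0 < tm_gap m (q m) - (x - 1) by lra.
  have [k hk] := exists_geometric_lt (tm_gap m (q m)) (invf_itv Q1) hx.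
  by exists k; rewrite val0; lra.
case: (ex_minnP exk) => -[|k] hk kmin.
  by move: hk; rewrite val0 expr0; lra.
have S1 := exprn2_gt1 m (q1 m.+1); set S := q m.+1 ^+ (2 ^ m) in S1.
have valS i : qval (q m.+1) (iter m Phi (ones_then_cycle i)) =
    1 + tm_gap m (q m.+1) * ((S + 1) / (S ^+ 2 + 1) - S^-1 ^+ i).
  have aE : alpha m.+2 = iter m Phi (alpha 2) by rewrite /alpha -iterD addn2.
  apply/eqP; rewrite -subr_eq0 opprD addrA subr_eq0 -{1}(qa m.+1) aE.
  rewrite qval_iter_Phi // -/S -[qval S (ones_then_cycle _)](subrK (qval S (alpha 1))).
  rewrite qval_ones_then_cycle // -addrA -[qval S (alpha 1) - _]opprB qval_alpha2 //.
  rewrite /tm_gap -/S; move: (S^-1 ^+ i) => t; apply/eqP.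
  have S2 : 1 < S ^+ 2 by nra.
  have S4 : 1 < S ^+ 4 by rewrite exprn_egt1.
  by field; do ?[apply/andP; split]; rewrite gt_eqF //; lra.
have hkS : qval (q m.+1) (iter m Phi (ones_then_cycle k.+1)) <= x.
  (* With a single 1 the value is exactly 1 + [tm_gap m.+1 (q m.+1)], at most [x] by the choice of
     [m]; otherwise minimality of [k] and [overlap] apply. *)
  rewrite valS -lerBrDl; case: k {hk} kmin => [_|k kmin].
    apply: le_trans gapx; rewrite (tm_gapS m (q1 m.+1)) -/S.
    rewrite le_eqVlt; apply/orP; left; apply/eqP; congr (_ * _).
    by field; do ?[apply/andP; split]; rewrite gt_eqF //; nra.
  have : qval (q m) (iter m Phi (ones_then_cycle k.+1)) <= x.
    by rewrite leNgt; apply/negP => /kmin; rewrite ltnn.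
  rewrite val0 -lerBrDl; apply: le_trans.
  have QS : Q <= S by rewrite lerXn2r ?nnegrE ?(ltW (qS m)) //; have := q1 m; have := q1 m.+1; lra.
  have Q85 : 8 / 5 <= Q.
    by apply: le_trans (q85 m) _; rewrite ler_eXnr ?expn_gt0 // ltW.
  have ov := overlap k Q85 QS.
  have gle := tm_gap_anti m (q85 m) (ltW (qS m)).
  have g0 := tm_gap_gt0 m (q1 m.+1).
  have t0 : 0 <= 1 - Q^-1 ^+ k.+1.
    by rewrite subr_ge0 exprn_ile1 //; have /andP[] := invf_itv Q1; [move=> ->|lra].
  by apply: le_trans (ler_wpM2l (ltW g0) ov) _; exact: ler_wpM2r.
have [|p /andP[qp pq] px] :=
  @qval_IVT R _ _ x (iter m Phi (ones_then_cycle k.+1)) (q1 m) (ltW (qS m)).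
  by rewrite hkS ltW.
have p1 : 1 < p by have := q1 m; lra.
(* Strictness makes the value of [alpha m.+1] in base [p] less than 1, as uniqueness requires. *)
have {}qp : q m < p.
  rewrite lt_neqAle qp andbT; apply/eqP => e; move: hk; rewrite e px ltxx //.
(* As [p] may equal [q m.+1], [alpha m.+2] only has value at least 1; the next index gives a strict
   inequality. *)
exists m.+3, p, (iter m Phi (ones_then_cycle k.+1)); split=> //.
- by rewrite p1; have := q2 m.+1; lra.
- apply: rtail_lt_univoque => //; apply: (@weakly_below_rtail_lt _ _ (alpha m.+1)) => //.
    by rewrite -(qa m) qval_lt_base.
  exact: weakly_below_iter_Phi.
have := qval_le_base (alpha m.+2) p1 pq; have := qval_alphaS_lt m.+1 p1.
by rewrite qa; lra.
Qed.

(** The target is a function [g] of the base so that induction applies: removing the first digit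
    turns it into q g(q) - c_0. Strict bounds at [p] persist nearby and force that digit. *)
Lemma expansion_prefix_near (R : realType) (p : R) L (g : R -> R) c : 1 < p ->
  {for p, continuous g} -> qval p c = g p ->
  (forall i, qval p (rtail c i) < 1) ->
  \forall q \near p, forall d, qval q d = g q -> forall k, (k < L)%N -> d k = c k.
Proof.
move=> p1; elim: L g c => [|L IH] g c gp hc hr; first by near=> q => d _ k.
have p0 : p != 0 by rewrite gt_eqF //; lra.
have hS : qval p (sdrop 1 c) = p * g p - (c 0%N)%:R.
  by rewrite -hc (qval_step c p1); field.
have g'p : {for p, continuous (fun q : R => q * g q - (c 0%N)%:R)}.
  have : (fun q : R => q * g q - (c 0%N)%:R) @ p --> p * g p - (c 0%N)%:R.
    by apply: cvgB; [apply: cvgM; [exact: cvg_id|exact: gp]|exact: cvg_cst].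
  exact.
have hrS i : qval p (rtail (sdrop 1 c) i) < 1 by rewrite rtail_sdrop.
have near' := IH _ _ g'p hS hrS.
have qg : (fun q : R => q * g q) @ p --> p * g p by apply: cvgM; [exact: cvg_id|exact: gp].
have inv : (fun q : R => (q - 1)^-1) @ p --> (p - 1)^-1.
  by apply: cvgV; [rewrite subr_eq0 gt_eqF|apply: cvgB; [exact: cvg_id|exact: cvg_cst]].
have head : \forall q \near p, if c 0%N then (q - 1)^-1 < q * g q else q * g q < 1.
  have := hr 0%N; rewrite rtail0; case: (c 0%N) hS => hS.
    rewrite qval_neg // hS => h.
    have : (fun q : R => q * g q - (q - 1)^-1) @ p --> p * g p - (p - 1)^-1 by exact: cvgB.
    move=> /cvgr_gt /(_ 0) near0; near=> q; rewrite -subr_gt0; near: q; apply: near0.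
    by rewrite /= in h; lra.
  by rewrite hS subr0; exact: (cvgr_lt _ qg).
near=> q => d hd.
have q1 : 1 < q by near: q; exact: lt_nbhsr.
have q0 : q != 0 by rewrite gt_eqF //; lra.
have hd' : (d 0%N)%:R + qval q (sdrop 1 d) = q * g q by rewrite -hd (qval_step d q1); field.
have d0 : d 0%N = c 0%N.
  have : if c 0%N then (q - 1)^-1 < q * g q else q * g q < 1 by near: q.
  have := qval_le (sdrop 1 d) q1; have := qval_ge0 (sdrop 1 d) q1.
  by rewrite -hd'; case: (d 0%N); case: (c 0%N) => //=; lra.
have hd'' : qval q (sdrop 1 d) = q * g q - (c 0%N)%:R by rewrite -hd' d0; ring.
have agree : forall d, qval q d = q * g q - (c 0%N)%:R ->
  forall k, (k < L)%N -> d k = sdrop 1 c k by near: q.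
by move=> [//|k] kL; exact: (agree (sdrop 1 d)).
Unshelve. all: by end_near. Qed.

(** Nearby bases have expansions close to [c], hence equal to [c] or of larger rank. Equality forces
    the base to be [p], since the value of [c] strictly decreases in the base. *)
Lemma isolated_or_higher_rank (R : realType) (x p : R) N m c : 1 < x ->
  1 < p <= 2 -> univoque p c -> qval p c = x -> 1 < qval p (alpha N) -> rank m c ->
  isolated (univoque_bases x) p \/
  exists (q : R) c' m', [/\ 1 < q <= 2, univoque q c', qval q c' = x,
    1 < qval q (alpha N) & (m < m' < N)%N /\ rank m' c'].
Proof.
move=> x1 /[dup] p12 /andP[p1 p2] uc cx hN rc.
have rt i := univoque_rtail_lt i p12 uc.
have Yc := rtail_lt_below p1 (ltW hN) rt.
have [L hL] := rank_jump Yc rc.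
have xp : {for p, continuous (fun _ : R => x)} by exact: cst_continuous.
have near1 := @expansion_prefix_near R p L (fun=> x) c p1 xp cx rt.
have near2 : \forall q \near p, 1 < qval q (alpha N).
  exact: (cvgr_gt _ (qval_continuous (d := alpha N) p1)).
have pU : univoque_bases x p by apply/univoque_basesP; split=> //; exists c.
have [h|/existsNP[q /not_implyP[[[hq1 hq2] qU] qp]]] :=
  pselect (forall q, ((forall d, qval q d = x -> forall k, (k < L)%N -> d k = c k) /\
     1 < qval q (alpha N)) /\ univoque_bases x q -> q = p).
  left; split; first exact/mem_set.
  eexists; first exact: (filterI near1 near2).
  apply/seteqP; split=> q /=; first exact: h.
  by move=> ->; split=> //; exact: (nbhs_singleton (filterI near1 near2)).
right; have /univoque_basesP[/[dup] q12 /andP[q1 q2] [c' c'x uc']] := qU.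
have Yc' := rtail_lt_below q1 (ltW hq2) (fun i => univoque_rtail_lt i q12 uc').
have [|e|[m' [mm' mN rm']]] := hL c' Yc'; first exact: hq1.
  (* After a leading 0 the tail has value below 1, which would give x < 1. *)
  have c0 : c 0%N.
    have := rt 0%N; rewrite rtail0; case: ifP => // c0 h.
    move: cx; rewrite (qval_step c p1) c0 add0r => cx.
    have [i0 i1] := andP (invf_itv p1); have := qval_ge0 (sdrop 1 c) p1.
    by nra.
  exfalso; apply: qp; subst c'; have [pq|pq|//] := ltgtP q p.
    by have := qval_lt_base q1 pq c0; rewrite cx c'x ltxx.
  by have := qval_lt_base p1 pq c0; rewrite cx c'x ltxx.
by exists q, c', m'; split=> //; rewrite mm' mN.
Qed.

Theorem proposition5p3 (R : realType) (x : R) (hx : 1 < x) :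
  exists p : R, isolated (univoque_bases x) p.
Proof.
have [N [p [c [p12 uc cx hN]]]] := exists_univoque_below_alpha hx.
have [p1 p2] := andP p12.
have [m _] := below_alpha_rank (rtail_lt_below p1 (ltW hN) (fun i => univoque_rtail_lt i p12 uc)).
have : (N <= m + N)%N by exact: leq_addl.
move: {2}N => k; elim: k m p c p12 uc cx hN {p1 p2} => [|k IH] m p c p12 uc cx hN hm rc.
all: have [iso|[q [c' [m' [q12 uc' c'x hN' [hm' rc']]]]]] :=
  isolated_or_higher_rank hx p12 uc cx hN rc.
- by exists p.
- by lia.
- by exists p.
by apply: (IH m' q c') => //; lia.
Qed.
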